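(* Let $p \ge 1$, let $\alpha \geq 1$, and let $\Pi = (\mathrm{MIN}, \mathrm{MAX})$ be an objective decomposition of $\{1,\ldots,p\}$. Let $S$ be a scalarization for $\Pi$ such that, in each instance of each $p$-objective optimization problem of type $\Pi$, every optimal solution set for $S$ is an $\alpha$-approximation set. Then, for any other objective decomposition $\Pi'$ of $\{1,\ldots,p\}$, there exists a scalarization $S'$ for $\Pi'$ such that, in each instance of each $p$-objective optimization problem of type $\Pi'$, every optimal solution set for $S'$ is an $\alpha$-approximation set.
   Context: $\mathbb{R}^p_> = \{y \in \mathbb{R}^p : y_i > 0 \text{ for } i=1,\ldots,p\}$. An objective decomposition is a pair $\Pi = (\mathrm{MIN},\mathrm{MAX})$ with $\mathrm{MIN} \subseteq \{1,\ldots,p\}$ and $\mathrm{MAX} = \{1,\ldots,p\}\setminus \mathrm{MIN}$. For $y,y'\in\mathbb{R}^p$, $y <_\Pi y'$ means $y_i < y'_i$ for all $i\in\mathrm{MIN}$ and $y_i > y'_i$ for all $i \in \mathrm{MAX}$. A $p$-objective optimization problem of type $\Pi$ is a set of instances; each instance $I=(X,f)$ consists of a set $X$ of feasible solutions and a map $f=(f_1,\ldots,f_p)$ on $X$, where $f_i$ is to be minimized for $i \in \mathrm{MIN}$ and maximized for $i\in\mathrm{MAX}$. Standing assumption: in every instance, $f(X)$ is a compact subset of $\mathbb{R}^p_>$. For $\alpha\ge 1$, $x\in X$ $\alpha$-approximates $x' \in X$ if $f_i(x) \le \alpha f_i(x')$ for all $i\in\mathrm{MIN}$ and $f_i(x)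 \ge \frac1\alpha f_i(x')$ for all $i\in\mathrm{MAX}$. A set $P\subseteq X$ is an $\alpha$-approximation set if every $x'\in X$ is $\alpha$-approximated by some $x\in P$. A scalarizing function for $\Pi$ is a continuous function $s:\mathbb{R}^p_>\to\mathbb{R}$ that is strictly $\Pi$-monotone, i.e. $y <_\Pi y'$ for $y,y'\in\mathbb{R}^p_>$ implies $s(y)<s(y')$. A scalarization for $\Pi$ is a set (finite or infinite) of scalarizing functions for $\Pi$. In an instance $(X,f)$ of type $\Pi$, $x\in X$ is optimal for $s$ if $s(f(x))\le s(f(x'))$ for all $x'\in X$. A set $P \subseteq X$ is an optimal solution set for $S$ if for each $s\in S$ there is some $x\in P$ that is optimal for $s$. *)

(* Defs.v *)
From HB Require Import structures.
From mathcomp Require Import all_boot all_order all_algebra.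
From mathcomp Require Import all_classical all_reals all_analysis.

Set Implicit Arguments.
Unset Strict Implicit.
Unset Printing Implicit Defensive.

Import Order.TTheory GRing.Theory Num.Theory.
Import numFieldNormedType.Exports.

Local Open Scope classical_set_scope.
Local Open Scope ring_scope.

Definition posvec (R : realType) (p : nat) : set 'rV[R]_p :=
  [set y | forall i : 'I_p, 0 < y ord0 i].
Arguments posvec : clear implicits.

(* MAX is determined by MIN, so a decomposition is stored as its MIN part. *)
Record decomposition (p : nat) := Decomposition { MIN : {set 'I_p} }.

Definition MAX (p : nat) (Pi : decomposition p) : {set 'I_p} := (~: MIN Pi)%SET.

Definition lt_decomp (R : realType) (p : nat) (Pi : decomposition p)
    (y y' : 'rV[R]_p) : Prop :=
  (forall i, i \in MIN Pi -> y ord0 i < y' ord0 i) /\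
  (forall i, i \in MAX Pi -> y ord0 i > y' ord0 i).

Record instance (R : realType) (p : nat) := Instance {
  feasible : Type;
  objective : feasible -> 'rV[R]_p;
  objective_compact : compact (range objective);
  objective_pos : range objective `<=` posvec R p
}.

(* The type Pi fixes the optimization direction of each objective; it does not
   restrict which pairs (X, f) may occur as instances. *)
Definition problem (R : realType) (p : nat) (Pi : decomposition p) :=
  set (instance R p).

Definition approximates (R : realType) (p : nat) (Pi : decomposition p)
    (alpha : R) (I : instance R p) (x x' : feasible I) : Prop :=
  (forall i, i \in MIN Pi ->
     objective x ord0 i <= alpha * objective x' ord0 i) /\
  (forall i, i \in MAX Pi ->
     objective x ord0 i >= alpha^-1 * objective x' ord0 i).

Definition approximation_set (R : realType) (p : nat) (Pi : decomposition p)
    (alpha : R) (I : instance R p) (P : set (feasible I)) : Prop :=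
  forall x' : feasible I, exists2 x, P x & approximates Pi alpha x x'.

(* A map on R^p_> is represented by a total function on R^p; only its values on
   R^p_> are ever constrained or used. *)
Definition scalarizing (R : realType) (p : nat) (Pi : decomposition p)
    (s : 'rV[R]_p -> R) : Prop :=
  {within posvec R p, continuous s} /\
  (forall y y', posvec R p y -> posvec R p y' ->
     lt_decomp Pi y y' -> s y < s y').

Definition scalarization (R : realType) (p : nat) (Pi : decomposition p)
    (S : set ('rV[R]_p -> R)) : Prop :=
  S `<=` [set s | scalarizing Pi s].

Definition optimal (R : realType) (p : nat) (I : instance R p)
    (s : 'rV[R]_p -> R) (x : feasible I) : Prop :=
  forall x' : feasible I, s (objective x) <= s (objective x').

Definition optimal_solution_set (R : realType) (p : nat) (I : instance R p)
    (S : set ('rV[R]_p -> R)) (P : set (feasible I)) : Prop :=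
  forall s, S s -> exists2 x, P x & optimal s x.

(* Main.v *)
(** Inverting the coordinates on which the two decompositions disagree is an
    involution of the positive orthant that exchanges minimization and
    maximization there, and it preserves [alpha]-approximation since the two
    ratios involved are reciprocal. So the scalarizing functions of [S]
    precomposed with this involution form the required scalarization. *)
Require Import Defs.
From HB Require Import structures.
From mathcomp Require Import all_boot all_order all_algebra.
From mathcomp Require Import all_classical all_reals all_analysis.

Set Implicit Arguments.
Unset Strict Implicit.
Unset Printing Implicit Defensive.

Import Order.TTheory GRing.Theory Num.Theory.
Import numFieldNormedType.Exports.

Local Open Scope classical_set_scope.
Local Open Scope ring_scope.

Definition invert_on (R : realType) (p : nat) (D : {set 'I_p})
    (y : 'rV[R]_p) : 'rV[R]_p :=
  \row_i (if i \in D then (y ord0 i)^-1 else y ord0 i).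

Lemma invert_on_pos (R : realType) (p : nat) (D : {set 'I_p}) (y : 'rV[R]_p) :
  posvec R p y -> posvec R p (invert_on D y).
Proof.
by move=> y0 i; rewrite mxE; case: ifP => _; rewrite ?invr_gt0; exact: y0.
Qed.

(** Each coordinate of [y] is nonzero, so inversion is continuous there. The limit is therefore
    taken along all [z] near [y], positive or not. *)
Lemma invert_on_cvg (R : realType) (p : nat) (D : {set 'I_p}) (y : 'rV[R]_p) :
  posvec R p y -> invert_on D z @[z --> y] --> invert_on D y.
Proof.
(* A neighbourhood of a row vector contains a box [V] of entrywise neighbourhoods, so finitely many
   coordinatewise limits suffice. *)
move=> y0 U [V V_near VU].
have coord i : (invert_on D z) ord0 i @[z --> y] --> (invert_on D y) ord0 i.
  under eq_fun do rewrite mxE.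
  rewrite mxE; case: ifP => _; last exact: coord_continuous.
  exact: (cvgV (F := nbhs y) (lt0r_neq0 (y0 i)) (@coord_continuous _ _ _ _ _ y)).
have : \forall z \near y, forall i : 'I_p, V ord0 i ((invert_on D z) ord0 i).
  by apply: (filter_forall (nbhs_filter y)) => i; exact: coord (V_near ord0 i).
by apply: filterS => z Vz; apply: VU => i j; rewrite (ord1 i); exact: Vz.
Qed.

Lemma invert_on_continuous (R : realType) (p : nat) (D : {set 'I_p}) :
  {within posvec R p, continuous (@invert_on R p D)}.
Proof.
apply/subspace_continuousP => y y0.
exact: cvg_within_filter (invert_on_cvg y0).
Qed.

Definition disagreement (p : nat) (Pi Pi' : decomposition p) : {set 'I_p} :=
  [set i | (i \in MIN Pi) != (i \in MIN Pi')]%SET.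

Lemma lt_decomp_invert_on (R : realType) (p : nat) (Pi Pi' : decomposition p)
    (y y' : 'rV[R]_p) :
  posvec R p y -> posvec R p y' -> lt_decomp Pi' y y' ->
  lt_decomp Pi (invert_on (disagreement Pi Pi') y)
    (invert_on (disagreement Pi Pi') y').
Proof.
move=> y0 y'0 [lt_min lt_max].
split=> i; [|rewrite inE]; move=> iPi; rewrite !mxE inE ?iPi ?(negbTE iPi);
  case: (boolP (i \in MIN Pi')) => iPi' /=.
- exact: lt_min.
- by rewrite ltf_pV2 ?posrE; [apply: lt_max; rewrite inE|exact: y0|exact: y'0].
- by rewrite ltf_pV2 ?posrE; [exact: lt_min|exact: y'0|exact: y0].
- by apply: lt_max; rewrite inE.
Qed.

Lemma scalarizing_invert_on (R : realType) (p : nat) (Pi Pi' : decomposition p)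
    (s : 'rV[R]_p -> R) :
  scalarizing Pi s -> scalarizing Pi' (s \o invert_on (disagreement Pi Pi')).
Proof.
move=> [/subspace_continuousP s_cont s_mono]; split.
  apply/subspace_continuousP => y y0.
  apply: cvg_comp (s_cont _ (invert_on_pos _ y0)) => U U_near.
  (* [U_near] only concerns positive points near the inverted [y]; since inversion preserves the
     orthant, it applies to the image of every positive [z] near [y]. *)
  apply: (filterS (Filter := nbhs_filter y) _
    (invert_on_cvg (D := disagreement Pi Pi') y0 U_near)).
  by move=> z Uz z0; apply: Uz; exact: invert_on_pos.
move=> y y' y0 y'0 yy'; apply: s_mono; try exact: invert_on_pos.
exact: lt_decomp_invert_on.
Qed.

Section InvertedInstance.
Variables (R : realType) (p : nat) (D : {set 'I_p}) (I : instance R p).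

Let inverted_objective := invert_on D \o @objective _ _ I.

Let inverted_compact : compact (range inverted_objective).
Proof.
rewrite /inverted_objective -(image_comp (objective (i:=I))).
apply: (continuous_compact _ (@objective_compact _ _ I)).
exact: (continuous_subspaceW (@objective_pos _ _ I)
  (@invert_on_continuous _ _ D)).
Qed.

Let inverted_pos : range inverted_objective `<=` posvec R p.
Proof.
move=> _ [x _ <-]; apply: invert_on_pos.
by apply: objective_pos; exists x.
Qed.

(** The feasible type is kept, so solutions and sets of solutions of [I] serve here without any
    transport. *)
Definition inverted_instance : instance R p :=
  Instance inverted_compact inverted_pos.

End InvertedInstance.

(** For positive [a], [b], the bound [a^-1 <= alpha * b^-1] amounts to [alpha^-1 * b <= a], and
    [alpha^-1 * b^-1 <= a^-1] to [a <= alpha * b]. *)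
Lemma approximates_inverted (R : realType) (p : nat) (Pi Pi' : decomposition p)
    (alpha : R) (I : instance R p) (x x' : feasible I) :
  0 < alpha ->
  approximates (I := inverted_instance (disagreement Pi Pi') I) Pi alpha x x' ->
  approximates Pi' alpha x x'.
Proof.
move=> alpha0 [le_min le_max].
have pos (z : feasible I) i : 0 < objective z ord0 i.
  by apply: (@objective_pos _ _ I); exists z.
split=> i; [|rewrite inE]; move=> iPi'; case: (boolP (i \in MIN Pi)) => iPi.
- by have := le_min i iPi; rewrite /= !mxE inE iPi iPi'.
- have := le_max i; rewrite /= !mxE !inE (negbTE iPi) iPi' /= -invfM.
  by rewrite lef_pV2 ?posrE ?mulr_gt0//; exact.
- have := le_min i iPi; rewrite /= !mxE !inE iPi (negbTE iPi') /=.
  (* Writing [alpha] as a double inverse makes the right-hand side a single inverse, that of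
     [alpha^-1] times the value at [x']. *)
  rewrite -[X in _ <= X * _]invrK -invfM.
  by rewrite lef_pV2 ?posrE ?mulr_gt0 ?invr_gt0.
- have := le_max i; rewrite /= !mxE !inE (negbTE iPi) (negbTE iPi') /=.
  exact.
Qed.

Theorem theorem3p6 (R : realType) (p : nat) (hp : (1 <= p)%N)
    (alpha : R) (halpha : 1 <= alpha)
    (Pi : decomposition p) (S : set ('rV[R]_p -> R))
    (hS : scalarization Pi S)
    (hSapprox : forall (Q : problem R Pi) (I : instance R p), Q I ->
       forall P : set (feasible I),
         optimal_solution_set S P -> approximation_set Pi alpha P)
    (Pi' : decomposition p) (hPi' : Pi' <> Pi) :
  exists S' : set ('rV[R]_p -> R),
    scalarization Pi' S' /\
    forall (Q : problem R Pi') (I : instance R p), Q I ->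
      forall P : set (feasible I),
        optimal_solution_set S' P -> approximation_set Pi' alpha P.
Proof.
pose D := disagreement Pi Pi'.
exists [set s \o invert_on D | s in S]; split.
  by move=> _ [s Ss <-]; apply: scalarizing_invert_on; exact: hS.
move=> Q I _ P Popt x'.
(* The problem made of all instances, [setT], certainly contains the inverted one. *)
have [s Ss|x Px xx'] :=
    hSapprox setT (inverted_instance D I) Logic.I P _ x'.
  (* Optimality for [s] in the inverted instance is, by computation, optimality for
     [s \o invert_on D] in [I]. *)
  by apply: (Popt (s \o invert_on D)); exists s.
by exists x => //; apply: approximates_inverted xx'; exact: lt_le_trans halpha.
Qed.
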